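(* (1) If $(\Gamma,\Omega,\Delta)\vdash M\Uparrow N:A$ and $\Gamma;\Omega;\Delta\vdash M:A$, then $\Gamma;\Omega;\Delta\vdash N\Uparrow A$. (2) If $(\Gamma,\Omega,\Delta)\vdash M\downarrow N:A$ and $\Gamma;\Omega;\Delta\vdash M:A$, then $\Gamma;\Omega;\Delta\vdash N\downarrow A$.
   Context: Strict $\lambda$-calculus over a signature $\Sigma$. Labels $k\in\{1,0,u\}$; types $A::=a\mid A_1\to^kA_2$; terms $c\mid x\mid\lambda x^k{:}A.M\mid M_1M_2^k$; $[N/x]M$ capture-avoiding substitution. Contexts: finite sets of declarations with distinct variables; commas denote disjoint union. Typing $\Gamma;\Omega;\Delta\vdash M:A$ (unrestricted, irrelevant, strict; disjoint): if $c{:}A\in\Sigma$ then $\Gamma;\Omega;\cdot\vdash c:A$; $(\Gamma,x{:}A);\Omega;\cdot\vdash x:A$; $\Gamma;\Omega;x{:}A\vdash x:A$ (no rule for $\Omega$); from $(\Gamma,x{:}A);\Omega;\Delta\vdash M:B$ infer $\Gamma;\Omega;\Delta\vdash\lambda x^u{:}A.M:A\to^uB$; from $\Gamma;(\Omega,x{:}A);\Delta\vdash M:B$ infer $\lambda x^0{:}A.M:A\to^0B$; from $\Gamma;\Omega;(\Delta,x{:}A)\vdash M:B$ infer $\lambda x^1{:}A.M:A\to^1B$; from $\Gamma;\Omega;\Delta\vdash M:A\to^uB$ and $(\Gamma,\Delta);\Omega;\cdot\vdash N:A$ infer $\Gamma;\Omega;\Delta\vdash MN^u:B$; from $\Gamma;\Omega;\Delta\vdash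 M:A\to^0B$ and $(\Gamma,\Omega,\Delta);\cdot;\cdot\vdash N:A$ infer $\Gamma;\Omega;\Delta\vdash MN^0:B$; from $(\Gamma,\Delta_N);\Omega;\Delta_M\vdash M:A\to^1B$ and $(\Gamma,\Delta_M);\Omega;\Delta_N\vdash N:A$ infer $\Gamma;\Omega;(\Delta_M,\Delta_N)\vdash MN^1:B$. Canonical/atomic forms $\Gamma;\Omega;\Delta\vdash M\Uparrow A$, $\Gamma;\Omega;\Delta\vdash M\downarrow A$: $c{:}A\in\Sigma$ gives $\Gamma;\Omega;\cdot\vdash c\downarrow A$; $(\Gamma,x{:}A);\Omega;\cdot\vdash x\downarrow A$; $\Gamma;\Omega;x{:}A\vdash x\downarrow A$; $M\downarrow a$ ($a$ atomic) gives $M\Uparrow a$; the three $\lambda$ rules as for typing with $\Uparrow$ in premise and conclusion; the three application rules as for typing with function premise and conclusion in $\downarrow$ and argument premise in $\Uparrow$. Conversion: $(\lambda x^k{:}A.M)N^k\to_{whr}[N/x]M$; $M\to_{whr}Q$ implies $MN^k\to_{whr}QN^k$. For a single context $\Psi$: $c{:}A\in\Sigma$ gives $\Psi\vdash c\downarrow c:A$; $x{:}A\in\Psi$ gives $\Psi\vdash x\downarrow x:A$; if $M\to_{whr}M'$ and $\Psi\vdash M'\Uparrow M'':a$ then $\Psi\vdash M\Uparrow M'':a$; if $\Psi\vdash M\downarrow N:a$ then $\Psi\vdash M\Uparrow N:a$; if $(\Psi,x{:}A)\vdash Mx^k\Uparrow N:B$ ($x$ fresh) then $\Psi\vdash M\Uparrow\lambda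 x^k{:}A.N:A\to^kB$; if $\Psi\vdash M\downarrow P:A\to^kB$ and $\Psi\vdash N\Uparrow Q:A$ then $\Psi\vdash MN^k\downarrow PQ^k:B$. *)

(* Defs.v *)
From HB Require Import structures.
From mathcomp Require Import all_boot.
From mathcomp Require Import finmap.

Set Implicit Arguments.
Unset Strict Implicit.
Unset Printing Implicit Defensive.

Local Open Scope fset_scope.
Local Open Scope fmap_scope.

(* [strict] is the label 1, [irrel] the label 0, [unres] the label u. *)
Inductive label : Type := strict | irrel | unres.

Inductive ty (B : Type) : Type :=
| base of B
| arr of label & ty B & ty B.

(* Terms modulo renaming of bound variables, in locally nameless style:
   variables are natural numbers when free and de Bruijn indices when bound.
   Only the locally closed expressions ([lc]) denote terms; every judgement
   below relates locally closed expressions only. *)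
Inductive tm (B C : Type) : Type :=
| con of C
| fvar of nat
| bvar of nat
| lam of label & ty B & tm B C
| app of label & tm B C & tm B C.

Arguments con {B C} _.
Arguments fvar {B C} _.
Arguments bvar {B C} _.

Fixpoint fv (B C : Type) (M : tm B C) : {fset nat} :=
  match M with
  | con _ | bvar _ => fset0
  | fvar x => [fset x]
  | lam _ _ M1 => fv M1
  | app _ M1 M2 => fv M1 `|` fv M2
  end.

Fixpoint lc_at (B C : Type) (n : nat) (M : tm B C) : bool :=
  match M with
  | con _ | fvar _ => true
  | bvar i => (i < n)%N
  | lam _ _ M1 => lc_at n.+1 M1
  | app _ M1 M2 => lc_at n M1 && lc_at n M2
  end.

Definition lc (B C : Type) (M : tm B C) : bool := lc_at 0 M.

Fixpoint open_at (B C : Type) (n : nat) (N M : tm B C) : tm B C :=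
  match M with
  | con c => con c
  | fvar x => fvar x
  | bvar i => if i == n then N else bvar i
  | lam k A M1 => lam k A (open_at n.+1 N M1)
  | app k M1 M2 => app k (open_at n N M1) (open_at n N M2)
  end.

(* If [lam k A M] encodes (lambda x^k:A. P), then [open M N] is [N/x]P; no
   capture can occur since the bound variables of M are indices and N is
   locally closed. *)
Definition open (B C : Type) (M N : tm B C) : tm B C := open_at 0 N M.

Definition ctx (B : Type) := {fmap nat -> ty B}.

Definition signature (B : Type) (C : choiceType) := {fmap C -> ty B}.

Definition disjctx (B : Type) (s : seq (ctx B)) : bool :=
  pairwise (fun G D : ctx B => [disjoint domf G & domf D]) s.

(* The comma of contexts is [+] on finite maps, whose operands have to be
   disjoint.  Disjointness is a premise of a rule only where it does not follow
   from the other premises: [typed Sg Ga Om De M A], [can Sg Ga Om De M A] and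
   [atm Sg Ga Om De M A] all imply [disjctx [:: Ga; Om; De]]. *)
Inductive typed (B : Type) (C : choiceType) (Sg : signature B C) :
    ctx B -> ctx B -> ctx B -> tm B C -> ty B -> Prop :=
| typed_con (Ga Om : ctx B) c A :
    disjctx [:: Ga; Om] -> Sg.[? c] = Some A ->
    typed Sg Ga Om [fmap] (con c) A
| typed_unres (Ga Om : ctx B) x A :
    disjctx [:: Ga; Om] -> Ga.[? x] = Some A ->
    typed Sg Ga Om [fmap] (fvar x) A
| typed_strict (Ga Om : ctx B) x A :
    disjctx [:: Ga; Om; [fmap].[x <- A]] ->
    typed Sg Ga Om [fmap].[x <- A] (fvar x) A
| typed_lam_unres (Ga Om De : ctx B) x A A' M :
    x \notin domf Ga `|` domf Om `|` domf De `|` fv M ->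
    typed Sg Ga.[x <- A] Om De (open M (fvar x)) A' ->
    typed Sg Ga Om De (lam unres A M) (arr unres A A')
| typed_lam_irrel (Ga Om De : ctx B) x A A' M :
    x \notin domf Ga `|` domf Om `|` domf De `|` fv M ->
    typed Sg Ga Om.[x <- A] De (open M (fvar x)) A' ->
    typed Sg Ga Om De (lam irrel A M) (arr irrel A A')
| typed_lam_strict (Ga Om De : ctx B) x A A' M :
    x \notin domf Ga `|` domf Om `|` domf De `|` fv M ->
    typed Sg Ga Om De.[x <- A] (open M (fvar x)) A' ->
    typed Sg Ga Om De (lam strict A M) (arr strict A A')
| typed_app_unres (Ga Om De : ctx B) A A' M N :
    typed Sg Ga Om De M (arr unres A A') ->
    typed Sg (Ga + De) Om [fmap] N A ->
    typed Sg Ga Om De (app unres M N) A'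
| typed_app_irrel (Ga Om De : ctx B) A A' M N :
    typed Sg Ga Om De M (arr irrel A A') ->
    typed Sg (Ga + Om + De) [fmap] [fmap] N A ->
    typed Sg Ga Om De (app irrel M N) A'
| typed_app_strict (Ga Om DeM DeN : ctx B) A A' M N :
    disjctx [:: Ga; Om; DeM; DeN] ->
    typed Sg (Ga + DeN) Om DeM M (arr strict A A') ->
    typed Sg (Ga + DeM) Om DeN N A ->
    typed Sg Ga Om (DeM + DeN) (app strict M N) A'.

Inductive can (B : Type) (C : choiceType) (Sg : signature B C) :
    ctx B -> ctx B -> ctx B -> tm B C -> ty B -> Prop :=
| can_atm (Ga Om De : ctx B) M a :
    atm Sg Ga Om De M (base a) ->
    can Sg Ga Om De M (base a)
| can_lam_unres (Ga Om De : ctx B) x A A' M :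
    x \notin domf Ga `|` domf Om `|` domf De `|` fv M ->
    can Sg Ga.[x <- A] Om De (open M (fvar x)) A' ->
    can Sg Ga Om De (lam unres A M) (arr unres A A')
| can_lam_irrel (Ga Om De : ctx B) x A A' M :
    x \notin domf Ga `|` domf Om `|` domf De `|` fv M ->
    can Sg Ga Om.[x <- A] De (open M (fvar x)) A' ->
    can Sg Ga Om De (lam irrel A M) (arr irrel A A')
| can_lam_strict (Ga Om De : ctx B) x A A' M :
    x \notin domf Ga `|` domf Om `|` domf De `|` fv M ->
    can Sg Ga Om De.[x <- A] (open M (fvar x)) A' ->
    can Sg Ga Om De (lam strict A M) (arr strict A A')
with atm (B : Type) (C : choiceType) (Sg : signature B C) :
    ctx B -> ctx B -> ctx B -> tm B C -> ty B -> Prop :=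
| atm_con (Ga Om : ctx B) c A :
    disjctx [:: Ga; Om] -> Sg.[? c] = Some A ->
    atm Sg Ga Om [fmap] (con c) A
| atm_unres (Ga Om : ctx B) x A :
    disjctx [:: Ga; Om] -> Ga.[? x] = Some A ->
    atm Sg Ga Om [fmap] (fvar x) A
| atm_strict (Ga Om : ctx B) x A :
    disjctx [:: Ga; Om; [fmap].[x <- A]] ->
    atm Sg Ga Om [fmap].[x <- A] (fvar x) A
| atm_app_unres (Ga Om De : ctx B) A A' M N :
    atm Sg Ga Om De M (arr unres A A') ->
    can Sg (Ga + De) Om [fmap] N A ->
    atm Sg Ga Om De (app unres M N) A'
| atm_app_irrel (Ga Om De : ctx B) A A' M N :
    atm Sg Ga Om De M (arr irrel A A') ->
    can Sg (Ga + Om + De) [fmap] [fmap] N A ->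
    atm Sg Ga Om De (app irrel M N) A'
| atm_app_strict (Ga Om DeM DeN : ctx B) A A' M N :
    disjctx [:: Ga; Om; DeM; DeN] ->
    atm Sg (Ga + DeN) Om DeM M (arr strict A A') ->
    can Sg (Ga + DeM) Om DeN N A ->
    atm Sg Ga Om (DeM + DeN) (app strict M N) A'.

Inductive whr (B C : Type) : tm B C -> tm B C -> Prop :=
| whr_beta k A M N :
    lc (lam k A M) -> lc N ->
    whr (app k (lam k A M) N) (open M N)
| whr_app k M Q N :
    lc N -> whr M Q ->
    whr (app k M N) (app k Q N).

(* [conv_can Sg P M N A] is P |- M (up) N : A, and [conv_atm Sg P M N A] is
   P |- M (down) N : A. *)
Inductive conv_can (B : Type) (C : choiceType) (Sg : signature B C) :
    ctx B -> tm B C -> tm B C -> ty B -> Prop :=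
| conv_can_whr (P : ctx B) M M' M'' a :
    whr M M' ->
    conv_can Sg P M' M'' (base a) ->
    conv_can Sg P M M'' (base a)
| conv_can_atm (P : ctx B) M N a :
    conv_atm Sg P M N (base a) ->
    conv_can Sg P M N (base a)
| conv_can_lam (P : ctx B) x k A A' M N :
    x \notin domf P `|` fv M `|` fv N ->
    conv_can Sg P.[x <- A] (app k M (fvar x)) (open N (fvar x)) A' ->
    conv_can Sg P M (lam k A N) (arr k A A')
with conv_atm (B : Type) (C : choiceType) (Sg : signature B C) :
    ctx B -> tm B C -> tm B C -> ty B -> Prop :=
| conv_atm_con (P : ctx B) c A :
    Sg.[? c] = Some A ->
    conv_atm Sg P (con c) (con c) A
| conv_atm_var (P : ctx B) x A :
    P.[? x] = Some A ->
    conv_atm Sg P (fvar x) (fvar x) A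
| conv_atm_app (P : ctx B) k A A' M M' N N' :
    conv_atm Sg P M M' (arr k A A') ->
    conv_can Sg P N N' A ->
    conv_atm Sg P (app k M N) (app k M' N') A'.

(* Main.v *)
Require Import Defs.
From HB Require Import structures.
From mathcomp Require Import all_boot.
From mathcomp Require Import finmap.

Set Implicit Arguments.
Unset Strict Implicit.
Unset Printing Implicit Defensive.

Local Open Scope fset_scope.
Local Open Scope fmap_scope.

(** The resource discipline separates from simple typing.  Whether a strict
variable is used and an irrelevant one is unused depends only on which argument
positions its occurrences lie under, and this is preserved by weak head
reduction and eta-expansion, hence by conversion.  The types of the canonical
form, on the other hand, are already recorded in the conversion derivation.
Putting the two together rebuilds the canonical typing derivation; a strict
context is split at an application according to which variables occur strictly
in the function part. *)

(** * Occurrences of variables graded by argument labels, and their behaviour under substitution *)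

(* [inl x] is the free variable x and [inr i] the de Bruijn index i. *)
Definition var : Type := (nat + nat)%type.

Definition lift (v : var) : var :=
  match v with inl x => inl x | inr i => inr i.+1 end.

(* [occ p v M]: v occurs in M under arguments with labels in p only. *)
Fixpoint occ (B C : Type) (p : pred label) (v : var) (M : tm B C) : bool :=
  match M with
  | con _ => false
  | fvar x => v == inl x
  | bvar i => v == inr i
  | lam _ _ M1 => occ p (lift v) M1
  | app k M1 M2 => occ p v M1 || p k && occ p v M2
  end.

Definition is_strict (k : label) : bool := if k is strict then true else false.

Definition is_relevant (k : label) : bool := if k is irrel then false else true.

Notation strict_occ := (occ is_strict).
Notation relevant_occ := (occ is_relevant).

(** The demand that a binder labelled [k] makes on its variable, read off the untyped body: a strict
    variable must be used strictly, an irrelevant one only inside irrelevant arguments. *)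
Definition binder_ok (B C : Type) (k : label) (v : var) (M : tm B C) : bool :=
  match k with
  | strict => strict_occ v M
  | irrel => ~~ relevant_occ v M
  | unres => true
  end.

Fixpoint binders_ok (B C : Type) (M : tm B C) : bool :=
  match M with
  | lam k _ M1 => binder_ok k (inr 0) M1 && binders_ok M1
  | app _ M1 M2 => binders_ok M1 && binders_ok M2
  | _ => true
  end.

Section Occurrences.

Variables B C : Type.
Implicit Types (M N : tm B C) (p : pred label) (v : var).

Lemma occ_bvar_lc_at p n i M : lc_at n M -> n <= i -> occ p (inr i) M = false.
Proof.
elim: M n i => //= [j|k A M IH|k M1 IH1 M2 IH2] n i.
- by move=> ltjn leni; apply/eqP => -[eq_ij]; move: ltjn; rewrite -eq_ij ltnNge leni.
- by move=> lcM leni; apply: IH lcM _.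
- by move=> /andP[lc1 lc2] leni; rewrite (IH1 n) ?(IH2 n) ?andbF.
Qed.

Lemma occ_lift_lc p v N : lc N -> occ p (lift v) N = occ p v N.
Proof. by case: v => //= i lcN; rewrite !(occ_bvar_lc_at p lcN). Qed.

Lemma occ_fv p x M : x \notin fv M -> occ p (inl x) M = false.
Proof.
elim: M => //= [y|k M1 IH1 M2 IH2].
  by rewrite in_fset1 => neq_xy; apply/eqP => -[eq_xy]; rewrite eq_xy eqxx in neq_xy.
by rewrite in_fsetU negb_or => /andP[/IH1-> /IH2->]; rewrite andbF.
Qed.

(** An occurrence inside an inserted copy of [N] lies under the arguments around the replaced index
    and those within [N], hence the conjunction. As [N] is locally closed, lifting [v] under a
    binder does not change whether it occurs in [N]. *)
Lemma occ_open_at p v n N M : lc N -> v != inr n ->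
  occ p v (open_at n N M) = occ p v M || occ p (inr n) M && occ p v N.
Proof.
move=> lcN; elim: M v n => //= [x|i|k A M IH|k M1 IH1 M2 IH2] v n vn.
- by rewrite orbF.
- have [->|neq_in] := eqVneq i n; first by rewrite eqxx (negbTE vn).
  have -> : (inr n == inr i :> var) = false.
    by apply/eqP => -[eq_ni]; rewrite eq_ni eqxx in neq_in.
  by rewrite orbF.
- have vn' : lift v != inr n.+1 by case: v vn.
  by rewrite IH // (occ_lift_lc _ _ lcN).
- rewrite IH1 // IH2 //.
  by case: (occ p v M1) => //=; case: (p k); case: (occ p v M2);
    case: (occ p v N); rewrite ?andbT ?andbF ?orbT ?orbF.
Qed.

(** A locally closed [N] contains no index of a surrounding binder, so inserting it leaves every
    binder condition of [M] as it was. *)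
Lemma binders_ok_open_at n N M : lc N -> binders_ok N ->
  binders_ok (open_at n N M) = binders_ok M.
Proof.
move=> lcN okN; elim: M n => //= [i|k A M IH|k M1 IH1 M2 IH2] n.
- by case: eqP.
- rewrite IH; congr (_ && _); rewrite /binder_ok.
  by case: k; rewrite // occ_open_at // (occ_bvar_lc_at _ lcN) // andbF orbF.
- by rewrite IH1 IH2.
Qed.

Lemma binders_ok_open_fvar M x : binders_ok (open M (fvar x)) = binders_ok M.
Proof. exact: binders_ok_open_at. Qed.

Lemma occ_open_fvar_neq p x y M :
  y != x -> occ p (inl y) (open M (fvar x)) = occ p (inl y) M.
Proof.
move=> neq_yx; rewrite occ_open_at //=.
have -> : (inl y == inl x :> var) = false.
  by apply/eqP => -[eq_yx]; rewrite eq_yx eqxx in neq_yx.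
by rewrite andbF orbF.
Qed.

Lemma occ_open_fvar p x M :
  x \notin fv M -> occ p (inl x) (open M (fvar x)) = occ p (inr 0) M.
Proof. by move=> xM; rewrite occ_open_at //= occ_fv // eqxx andbT. Qed.

Lemma binder_ok_open_fvar k x M :
  x \notin fv M -> binder_ok k (inl x) (open M (fvar x)) = binder_ok k (inr 0) M.
Proof. by move=> xM; case: k => //=; rewrite occ_open_fvar. Qed.

End Occurrences.

(** * Conversion preserves the resource discipline *)

Section ConversionResources.

Variables B C : Type.
Implicit Types (M N : tm B C).

(** Only implications can be expected: contracting an unrestricted redex may turn an occurrence in
    the argument into a strict one, or erase it. *)
Definition resource_le M N : Prop :=
  forall x, (strict_occ (inl x) M -> strict_occ (inl x) N) /\
            (relevant_occ (inl x) N -> relevant_occ (inl x) M).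

Lemma whr_resources M M' :
  whr M M' -> binders_ok M -> binders_ok M' /\ resource_le M M'.
Proof.
elim=> {M M'} [k A M N lcM lcN|k M Q N lcN _ IH] /=.
- move=> /andP[/andP[okk okM] okN]; split; first by rewrite binders_ok_open_at.
  (* The binder condition settles each label: a strict bound variable carries the strict occurrences
     of [N] into the contractum, an irrelevant one carries no relevant occurrence there, and an
     unrestricted argument has no strict occurrence to preserve. *)
  move=> x; rewrite !occ_open_at //; case: k okk {lcM} => /=.
  + by move=> ->; split=> // /orP[->//|/andP[_ ->]]; rewrite orbT.
  + by move=> /negbTE->; rewrite /= !orbF; split=> // ->.
  + by move=> _; rewrite orbF; split=> [->//|/orP[->//|/andP[_ ->]]]; rewrite orbT.
- move=> /andP[/IH[okQ le_MQ] okN]; split; first by rewrite okQ.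
  move=> x /=; have [strMQ relMQ] := le_MQ x.
  split=> /orP[]; first by move/strMQ=> ->.
  + by move=> ->; rewrite orbT.
  + by move/relMQ=> ->.
  + by move=> ->; rewrite orbT.
Qed.

Lemma resource_le_trans M N Q :
  resource_le M N -> resource_le N Q -> resource_le M Q.
Proof.
move=> leMN leNQ x; have [sMN rMN] := leMN x; have [sNQ rNQ] := leNQ x.
by split=> [/sMN/sNQ|/rNQ/rMN].
Qed.

(** The only [x] in the expanded application is the argument labelled [k], so it is strict for a
    strict label and not relevant for an irrelevant one. The comparison hands this status to the
    bound variable of the abstraction. *)
Lemma eta_resources k x M N :
    x \notin fv M -> x \notin fv N ->
    resource_le (app k M (fvar x)) (open N (fvar x)) ->
  binder_ok k (inr 0) N /\ forall A, resource_le M (lam k A N).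
Proof.
move=> xM xN le_MN; split.
  rewrite -(binder_ok_open_fvar k xN); have [strMN relMN] := le_MN x.
  case: k strMN relMN {le_MN} => //= strMN relMN.
  - by apply: strMN; rewrite eqxx orbT.
  - by apply/negP => /relMN; rewrite occ_fv.
move=> A y /=; have [->|neq_yx] := eqVneq y x; first by rewrite !occ_fv.
have [] := le_MN y; rewrite /= !occ_open_fvar_neq //.
have -> : (inl y == inl x :> var) = false.
  by apply/eqP => -[eq_yx]; rewrite eq_yx eqxx in neq_yx.
by rewrite !andbF !orbF.
Qed.

End ConversionResources.

Scheme conv_can_mut := Minimality for conv_can Sort Prop
with conv_atm_mut := Minimality for conv_atm Sort Prop.
Combined Scheme conv_mutind from conv_can_mut, conv_atm_mut.

(** Head reduction and eta-expansion are covered by the two preceding analyses; applications follow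
    because both kinds of occurrence are monotone in the function and argument parts. *)
Lemma conv_resources (B : Type) (C : choiceType) (Sg : signature B C) :
  (forall P M N A, conv_can Sg P M N A ->
     binders_ok M -> binders_ok N /\ resource_le M N) /\
  (forall P M N A, conv_atm Sg P M N A ->
     binders_ok M -> binders_ok N /\ resource_le M N).
Proof.
apply: conv_mutind => //.
- move=> _ M M' M'' _ /whr_resources red _ IH /red[/IH[okM'' le2] le1].
  by split=> //; apply: resource_le_trans le1 le2.
- move=> P x k A A' M N; rewrite !in_fsetU !negb_or => /andP[/andP[_ xM] xN] _ IH okM.
  have [|okN le_MN] := IH; first by rewrite /= okM.
  have [okk leM] := eta_resources xM xN le_MN.
  by rewrite /= okk -(binders_ok_open_fvar N x).
- move=> P k A A' M M' N N' _ IHM _ IHN /= /andP[/IHM[-> leM] /IHN[-> leN]].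
  split=> // x /=; have [sM rM] := leM x; have [sN rN] := leN x.
  split=> /orP[].
  + by move/sM=> ->.
  + by move=> /andP[-> /sN->]; rewrite orbT.
  + by move/rM=> ->.
  + by move=> /andP[-> /rN->]; rewrite orbT.
Qed.

(** * Disjointness of contexts *)

Section Contexts.

Variables (B : Type) (C : choiceType) (Sg : signature B C).
Implicit Types (Ga Om De P : ctx B) (M N : tm B C).

(** The pointwise form reduces later disjointness goals to a Boolean case analysis at a single
    variable. *)
Lemma disjctx3P Ga Om De :
  reflect (forall y, [&& ~~ ((y \in domf Ga) && (y \in domf Om)),
                         ~~ ((y \in domf Ga) && (y \in domf De)) &
                         ~~ ((y \in domf Om) && (y \in domf De))])
          (disjctx [:: Ga; Om; De]).
Proof.
rewrite /disjctx /= !andbT; apply: (iffP idP).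
  move=> /andP[/andP[/fdisjointP d1 /fdisjointP d2] /fdisjointP d3] y.
  by rewrite !negb_and; apply/and3P; split; rewrite -implybE; apply/implyP;
    [exact: d1 | exact: d2 | exact: d3].
move=> d; apply/andP; split; first apply/andP; first split.
all: apply/fdisjointP => y yA; have := d y; rewrite yA.
all: by case: (y \in _) => //=; rewrite ?andbF.
Qed.

Lemma disjctx2 Ga Om : disjctx [:: Ga; Om] = disjctx [:: Ga; Om; [fmap]].
Proof. by rewrite /disjctx /= !fdisjointX0 !andbT. Qed.

Lemma disjctx4 Ga Om De1 De2 :
  disjctx [:: Ga; Om; De1; De2] =
  disjctx [:: Ga; Om; De1 + De2] && disjctx [:: De1; De2].
Proof.
rewrite /disjctx /= !fdisjointXU !andbT -!andbA.
by case: (boolP (fdisjoint (domf De1) (domf De2))) => [/fsetDidPl->|_]; rewrite ?andbF.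
Qed.

Lemma mem_setf_ctx P x A y :
  (y \in domf P.[x <- A]) = (y == x) || (y \in domf P).
Proof. by rewrite mem_setf. Qed.

Lemma mem_catf_ctx P Q y :
  (y \in domf (P + Q)) = (y \in domf P) || (y \in domf Q).
Proof. by rewrite mem_catf. Qed.

(** * Resource conditions extracted from typing *)

Definition resources Ga Om De M : Prop :=
  [/\ disjctx [:: Ga; Om; De], binders_ok M,
      forall y, y \in domf De -> strict_occ (inl y) M &
      forall y, y \in domf Om -> ~~ relevant_occ (inl y) M].

(** The zone changes in the application rules match the labels that [occ] looks through: both parts
    of a strict application supply strict occurrences, and irrelevant variables become available
    exactly in arguments that [relevant_occ] skips. *)
Lemma typed_resources Ga Om De M A :
  typed Sg Ga Om De M A -> resources Ga Om De M.
Proof.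
elim=> {Ga Om De M A}.
- by move=> Ga Om c A; rewrite disjctx2.
- move=> Ga Om x A dj Gax; rewrite disjctx2 in dj; split=> //= y yOm.
  apply/eqP => -[eq_yx]; move/disjctx3P: dj => /(_ y).
  by rewrite yOm eq_yx -fndSome Gax.
- move=> Ga Om x A dj; split=> // y.
    by rewrite mem_setf_ctx in_fset0 orbF => /eqP->; exact: eqxx.
  move=> yOm; apply/eqP => -[eq_yx]; move/disjctx3P: dj => /(_ y).
  by rewrite yOm mem_setf_ctx eq_yx eqxx !andbF.
- move=> Ga Om De x A A' M.
  rewrite !in_fsetU !negb_or => /andP[/andP[/andP[xGa xOm] xDe] xM].
  move=> _ [/disjctx3P dj okM sM rM]; split=> /=.
  + apply/disjctx3P => y; have := dj y.
    rewrite mem_setf_ctx; case: (y == x) => //=.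
    by case: (y \in domf Ga); case: (y \in domf De); case: (y \in domf Om).
  + by rewrite -(binders_ok_open_fvar M x).
  + move=> y yDe; rewrite -(occ_open_fvar_neq _ (x := x)) ?sM //.
    by apply: contraNneq xDe => <-.
  + move=> y yOm; rewrite -(occ_open_fvar_neq _ (x := x)) ?rM //.
    by apply: contraNneq xOm => <-.
- move=> Ga Om De x A A' M.
  rewrite !in_fsetU !negb_or => /andP[/andP[/andP[xGa xOm] xDe] xM].
  move=> _ [/disjctx3P dj okM sM rM]; split=> /=.
  + apply/disjctx3P => y; have := dj y.
    rewrite mem_setf_ctx; case: (y == x) => //=.
    by case: (y \in domf Ga); case: (y \in domf De); case: (y \in domf Om).
  + rewrite -(occ_open_fvar _ xM) rM ?mem_setf_ctx ?eqxx //.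
    by rewrite -(binders_ok_open_fvar M x).
  + move=> y yDe; rewrite -(occ_open_fvar_neq _ (x := x)) ?sM //.
    by apply: contraNneq xDe => <-.
  + move=> y yOm; rewrite -(occ_open_fvar_neq _ (x := x)).
      by rewrite rM // mem_setf_ctx yOm orbT.
    by apply: contraNneq xOm => <-.
- move=> Ga Om De x A A' M.
  rewrite !in_fsetU !negb_or => /andP[/andP[/andP[xGa xOm] xDe] xM].
  move=> _ [/disjctx3P dj okM sM rM]; split=> /=.
  + apply/disjctx3P => y; have := dj y.
    rewrite mem_setf_ctx; case: (y == x) => //=.
    by case: (y \in domf Ga); case: (y \in domf De); case: (y \in domf Om).
  + rewrite -(occ_open_fvar _ xM) sM ?mem_setf_ctx ?eqxx //.
    by rewrite -(binders_ok_open_fvar M x).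
  + move=> y yDe; rewrite -(occ_open_fvar_neq _ (x := x)).
      by rewrite sM // mem_setf_ctx yDe orbT.
    by apply: contraNneq xDe => <-.
  + move=> y yOm; rewrite -(occ_open_fvar_neq _ (x := x)) ?rM //.
    by apply: contraNneq xOm => <-.
- move=> Ga Om De A A' M N _ [dj okM sM rM] _ [_ okN _ rN].
  split=> //= [|y yDe|y yOm]; first by rewrite okM.
    by rewrite sM.
  by rewrite negb_or rM ?rN.
- move=> Ga Om De A A' M N _ [dj okM sM rM] _ [_ okN _ _].
  split=> //= [|y yDe|y yOm]; first by rewrite okM.
    by rewrite sM.
  by rewrite orbF rM.
- move=> Ga Om DeM DeN A A' M N dj4 _ [/disjctx3P djM okM sM rM].
  move=> _ [/disjctx3P djN okN sN rN]; split=> [|/=|y|y yOm /=].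
  + apply/disjctx3P => y; have := djM y; have := djN y.
    rewrite !mem_catf_ctx.
    by do ?case: (y \in _) => //=.
  + by rewrite okM.
  + by rewrite mem_catf_ctx /= => /orP[/sM->//|/sN->]; rewrite orbT.
  + by rewrite negb_or rM ?rN.
Qed.

(** Concatenation lets its right operand override, so regrouping relies on disjointness. This is the
    regrouping required by the function premise of a strict application. *)
Lemma catf_rot_strict Ga Om De1 De2 :
    disjctx [:: Ga; Om; De1 + De2] -> disjctx [:: De1; De2] ->
  Ga + Om + (De1 + De2) = Ga + De2 + Om + De1.
Proof.
move=> /disjctx3P dj; rewrite disjctx2 => /disjctx3P dj'.
apply/fmapP => y; have := dj y; have := dj' y.
rewrite !fnd_cat !mem_catf_ctx.
by do ?case: (y \in _) => //=.
Qed.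

(** * Distributing resources over the parts of an application *)

Lemma resources_app_unres Ga Om De M N :
    resources Ga Om De (app unres M N) ->
  resources Ga Om De M /\ resources (Ga + De) Om [fmap] N.
Proof.
move=> [dj /= /andP[okM okN] s r]; split; split=> //.
- by move=> y /s; rewrite orbF.
- by move=> y /r; rewrite negb_or => /andP[].
- apply/disjctx3P => y; move/disjctx3P: dj => /(_ y).
  by rewrite mem_catf_ctx in_fset0 !andbF; do ?case: (y \in _).
- by move=> y /r; rewrite negb_or => /andP[].
Qed.

Lemma resources_app_irrel Ga Om De M N :
    resources Ga Om De (app irrel M N) ->
  resources Ga Om De M /\ resources (Ga + Om + De) [fmap] [fmap] N.
Proof.
move=> [dj /= /andP[okM okN] s r]; split; split=> //.
- by move=> y /s; rewrite orbF.
- by move=> y /r; rewrite orbF.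
- by apply/disjctx3P => y; rewrite !in_fset0 !andbF.
Qed.

(** A split of [De] has to be invented. A variable strict in both parts may go to either side, since
    each side sees the strict variables of the other as unrestricted. *)
Lemma resources_app_strict Ga Om De M N :
    resources Ga Om De (app strict M N) ->
  exists DeM DeN, [/\ De = DeM + DeN, disjctx [:: Ga; Om; DeM; DeN],
    resources (Ga + DeN) Om DeM M & resources (Ga + DeM) Om DeN N].
Proof.
move=> [/disjctx3P dj /= /andP[okM okN] s r].
(* Variables strict in [M] go to the function; any other variable of [De] must then be strict in
   [N]. *)
pose q y := strict_occ (inl y) M.
pose DeM := filterf De q; pose DeN := filterf De (predC q).
have inM y : (y \in domf DeM) = (y \in domf De) && q y by rewrite mem_filterf.
have inN y : (y \in domf DeN) = (y \in domf De) && ~~ q y by rewrite mem_filterf.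
have DeE : De = DeM + DeN.
  apply/fmapP => y; rewrite fnd_cat inN !fnd_filterf /=.
  by case: (boolP (y \in domf De)) => [_|/not_fnd->]; case: (q y).
have djMN : disjctx [:: DeM; DeN].
  rewrite disjctx2; apply/disjctx3P => y; rewrite inM inN in_fset0 !andbF !andbT.
  by case: (q y); rewrite !andbF.
have dj4 : disjctx [:: Ga; Om; DeM; DeN].
  by rewrite disjctx4 -DeE djMN andbT; apply/disjctx3P.
exists DeM, DeN; split=> //.
- split=> //.
  + apply/disjctx3P => y; have := dj y; rewrite mem_catf_ctx inM inN.
    by case: (q y); do ?case: (y \in _) => //=.
  + by move=> y; rewrite inM => /andP[].
  + by move=> y /r; rewrite negb_or => /andP[].
- split=> //.
  + apply/disjctx3P => y; have := dj y; rewrite mem_catf_ctx inM inN.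
    by case: (q y); do ?case: (y \in _) => //=.
  + by move=> y; rewrite inN => /andP[/s]; rewrite -/(q y); case: (q y).
  + by move=> y /r; rewrite negb_or => /andP[].
Qed.

(** * Rebuilding canonical derivations *)

(** Conversion supplies the types and [resources] the zones. The division of [P] into three zones is
    quantified inside the induction because it changes at every application argument and binder. *)
Lemma conv_resources_can :
  (forall P M N A, conv_can Sg P M N A -> forall Ga Om De,
     P = Ga + Om + De -> resources Ga Om De N -> can Sg Ga Om De N A) /\
  (forall P M N A, conv_atm Sg P M N A -> forall Ga Om De,
     P = Ga + Om + De -> resources Ga Om De N -> atm Sg Ga Om De N A).
Proof.
apply: conv_mutind => //.
- by move=> P M N a _ IH Ga Om De defP res; apply/can_atm/IH.
- move=> P x k A A' M N xPMN _ IH Ga Om De defP [/disjctx3P dj /= /andP[okk okN] s r].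
  move: xPMN; rewrite defP 2!in_fsetU !mem_catf_ctx !negb_or -!andbA.
  move=> /and5P[xGa xOm xDe xM xN].
  have fresh : x \notin domf Ga `|` domf Om `|` domf De `|` fv N.
    by rewrite !in_fsetU !negb_or xGa xOm xDe.
  have okN' : binders_ok (open N (fvar x)) by rewrite binders_ok_open_fvar.
  have s' y : y \in domf De -> strict_occ (inl y) (open N (fvar x)).
    by move=> yDe; rewrite occ_open_fvar_neq ?s //; apply: contraNneq xDe => <-.
  have r' y : y \in domf Om -> ~~ relevant_occ (inl y) (open N (fvar x)).
    by move=> yOm; rewrite occ_open_fvar_neq ?r //; apply: contraNneq xOm => <-.
  (* The label decides which zone receives [x], and [okk] supplies the occurrence condition of that
     zone. *)
  case: k okk {s r} IH => /= okk IH.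
  + apply: (can_lam_strict fresh); apply: IH.
      by rewrite defP; apply/fmapP => y; rewrite !(fnd_set, fnd_cat) mem_setf_ctx; case: eqP.
    split=> // [|y].
      apply/disjctx3P => y; have := dj y; rewrite mem_setf_ctx.
      by case: eqP => [->|//]; rewrite (negbTE xGa) (negbTE xOm).
    by rewrite mem_setf_ctx => /orP[/eqP->|/s'//]; rewrite occ_open_fvar.
  + apply: (can_lam_irrel fresh); apply: IH.
      rewrite defP; apply/fmapP => y; rewrite !(fnd_set, fnd_cat) mem_setf_ctx.
      by case: eqP => [->|//]; rewrite (negbTE xDe).
    split=> // [|y].
      apply/disjctx3P => y; have := dj y; rewrite mem_setf_ctx.
      by case: eqP => [->|//]; rewrite (negbTE xGa) (negbTE xDe).
    by rewrite mem_setf_ctx => /orP[/eqP->|/r'//]; rewrite occ_open_fvar.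
  + apply: (can_lam_unres fresh); apply: IH.
      rewrite defP; apply/fmapP => y; rewrite !(fnd_set, fnd_cat).
      by case: eqP => [->|//]; rewrite (negbTE xDe) (negbTE xOm).
    split=> //; apply/disjctx3P => y; have := dj y; rewrite mem_setf_ctx.
    by case: eqP => [->|//]; rewrite (negbTE xOm) (negbTE xDe).
- move=> P c A Sgc Ga Om De _ [dj _ s _].
  (* No variable occurs in a constant, so no strict variable can be pending. *)
  have De0 : De = [fmap].
    by apply/fmapP => y; rewrite fnd_fmap0 not_fnd //; apply/negP => /s.
  by rewrite De0 -disjctx2 in dj *; apply: atm_con.
- move=> P x A Px Ga Om De defP [dj _ s r]; rewrite {}defP !fnd_cat in Px.
  (* The zone of [x] selects the rule: if strict, [x] is the only member of [De], as each member
     must occur in the term; irrelevant is impossible because this occurrence is relevant; otherwise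
     [De] is empty and [x] is unrestricted. *)
  case: (boolP (x \in domf De)) Px => [xDe Dex|xDe].
    have DeE : De = [fmap].[x <- A].
      apply/fmapP => y; rewrite fnd_set fnd_fmap0; have [->//|neq_yx] := eqVneq y x.
      by rewrite not_fnd //; apply/negP => /s /eqP -[eq_yx]; rewrite eq_yx eqxx in neq_yx.
    by rewrite DeE in dj *; apply: atm_strict.
  case: (boolP (x \in domf Om)) => [/r|_ Gax]; first by rewrite /= eqxx.
  have De0 : De = [fmap].
    apply/fmapP => y; rewrite fnd_fmap0 not_fnd //; apply/negP => yDe.
    by move/eqP: (s _ yDe) => -[eq_yx]; rewrite -eq_yx yDe in xDe.
  by rewrite De0 -disjctx2 in dj *; apply: atm_unres.
- move=> P k A A' M M' N N' _ IHM _ IHN Ga Om De defP; case: k IHM => IHM res.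
  + have [DeM [DeN [DeE dj4 resM resN]]] := resources_app_strict res.
    have [dj _ _ _] := res; rewrite {}DeE {res} in defP dj *.
    have := dj4; rewrite disjctx4 => /andP[_ djMN].
    apply: (atm_app_strict dj4); first by apply: IHM => //; rewrite defP catf_rot_strict.
    apply: IHN => //; rewrite defP; apply/fmapP => y.
    move: dj => /disjctx3P /(_ y).
    move: djMN; rewrite disjctx2 => /disjctx3P /(_ y).
    by rewrite !fnd_cat !mem_catf_ctx; do ?case: (y \in _) => //=.
  + have [resM resN] := resources_app_irrel res.
    apply: atm_app_irrel; first exact: IHM.
    by apply: IHN => //; rewrite !catf0.
  + have [resM resN] := resources_app_unres res; have [/disjctx3P dj _ _ _] := res.
    apply: atm_app_unres; first exact: IHM.
    apply: IHN => //; rewrite catf0 defP; apply/fmapP => y; move: (dj y).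
    by rewrite !fnd_cat; do ?case: (y \in _) => //=.
Qed.

End Contexts.

Theorem theorem4p2 (B : Type) (C : choiceType) (Sg : signature B C)
    (Ga Om De : ctx B) (M N : tm B C) (A : ty B) :
  (conv_can Sg (Ga + Om + De) M N A ->
     typed Sg Ga Om De M A -> can Sg Ga Om De N A) /\
  (conv_atm Sg (Ga + Om + De) M N A ->
     typed Sg Ga Om De M A -> atm Sg Ga Om De N A).
Proof.
(* With the contexts fixed, [resource_le] points in the direction both conditions need: strict
   occurrences persist and no relevant one appears. *)
have transport : resources Ga Om De M -> binders_ok N -> resource_le M N ->
    resources Ga Om De N.
  move=> [dj _ s r] okN leMN; split=> // y; have [sMN rMN] := leMN y.
    by move/s/sMN.
  by move/r; apply: contra.
split=> conv /typed_resources res; have [_ okM _ _] := res.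
- have [okN leMN] := (conv_resources Sg).1 _ _ _ _ conv okM.
  exact: (conv_resources_can Sg).1 _ _ _ _ conv _ _ _ erefl (transport res okN leMN).
- have [okN leMN] := (conv_resources Sg).2 _ _ _ _ conv okM.
  exact: (conv_resources_can Sg).2 _ _ _ _ conv _ _ _ erefl (transport res okN leMN).
Qed.
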